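(* Let $\lambda>0$ and $\mu$ be real numbers, and let $C_4$ be the cycle on $4$ vertices. The multiset $\{0, \lambda,\lambda, \mu\}$ is Laplacian realizable for $C_4$ if and only if $\mu \geq 2\lambda$.
   Context: For a finite simple graph $G$ on $n$ vertices, $\mathcal{S}_L(G)$ denotes the set of $n\times n$ real symmetric matrices $A=[a_{i,j}]$ such that $a_{i,j}<0$ if $\{i,j\}\in E(G)$, $a_{i,j}=0$ if $i\neq j$ and $\{i,j\}\notin E(G)$, and $a_{i,i}=-\sum_{k\neq i}a_{i,k}$ for all $i$. A multiset of $n$ real numbers is Laplacian realizable for $G$ if it is the spectrum (multiset of eigenvalues) of some $A\in\mathcal{S}_L(G)$. *)

(* Defs.v *)
From HB Require Import structures.
From mathcomp Require Import all_boot all_order all_algebra.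
From mathcomp Require Import reals.

Set Implicit Arguments.
Unset Strict Implicit.
Unset Printing Implicit Defensive.

Import Order.TTheory GRing.Theory Num.Theory.
Local Open Scope ring_scope.

Record sgraph (n : nat) := SGraph {
  adj : rel 'I_n;
  adj_sym : symmetric adj;
  adj_irrefl : irreflexive adj }.

Definition cycle_adj (n : nat) : rel 'I_n :=
  fun i j => (j == ordS i) || (i == ordS j).

Lemma cycle_adj_sym (n : nat) : symmetric (@cycle_adj n).
Proof. by move=> i j; rewrite /cycle_adj orbC. Qed.

Lemma cycle_adj_irrefl (n : nat) : (2 < n)%N -> irreflexive (@cycle_adj n).
Proof.
move=> n_gt2 i; rewrite /cycle_adj orbb; apply/negbTE/eqP => /(congr1 val) /=.
have [i1_lt | i1_ge] := ltnP i.+1 n.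
  by rewrite modn_small // => /esym /eqP; rewrite gtn_eqF.
have -> : i.+1 = n by apply/eqP; rewrite eqn_leq i1_ge ltn_ord.
by rewrite modnn => i0; move: i1_ge; rewrite i0 leqNgt (ltnW n_gt2).
Qed.

Definition cycle_graph (n : nat) (n_gt2 : (2 < n)%N) : sgraph n :=
  SGraph (@cycle_adj_sym n) (cycle_adj_irrefl n_gt2).

Definition C4 : sgraph 4 := @cycle_graph 4 isT.

(* The set S_L(G) of generalized Laplacian matrices of G. *)
Definition SL (R : realType) (n : nat) (G : sgraph n) (A : 'M[R]_n) : Prop :=
  [/\ A^T = A,
      forall i j : 'I_n, adj G i j -> A i j < 0,
      forall i j : 'I_n, i != j -> ~~ adj G i j -> A i j = 0
    & forall i : 'I_n, A i i = - \sum_(k < n | k != i) A i k].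

(* A multiset of n reals is a tuple up to reordering; the product below is
   invariant under reordering and records the algebraic multiplicities. *)
Definition is_spectrum (R : realType) (n : nat) (s : n.-tuple R)
    (A : 'M[R]_n) : Prop :=
  char_poly A = \prod_(x <- s) ('X - x%:P).

Definition laplacian_realizable (R : realType) (n : nat) (G : sgraph n)
    (s : n.-tuple R) : Prop :=
  exists A : 'M[R]_n, SL G A /\ is_spectrum s A.

(* Main.v *)
Require Import Defs.
From mathcomp Require Import all_boot all_order all_algebra.
From mathcomp Require Import reals.
From mathcomp Require Import ring lra.

(** Give the edges 01, 12, 23, 30 of the 4-cycle weights [a, b, c, d > 0].  In
    the orthonormal basis
      (1,1,1,1)/2, (1,-1,1,-1)/2, (1,1,-1,-1)/2, (1,-1,-1,1)/2
    the weighted Laplacian is the direct sum of the zero block and of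
<<
        M = | a+b+c+d  d-b  a-c |
            |   d-b    b+d   0  |
            |   a-c     0   a+c |
>>
    so the nonzero part of the spectrum is governed by the elementary symmetric
    functions of [M] ([spectrum_C4_laplacian]).

    If [lambda] is a double eigenvalue of [M], the symmetric matrix
    [M - lambda] has rank at most one, so its principal 2-minors vanish
    ([principal_minors_eq0]).  The minor on the last two indices gives
    [lambda = b + d] or [lambda = a + c], hence [lambda < a + b + c + d]; the
    other two read
      [(a+b+c+d - lambda)(b+d - lambda) = (d-b)^2] and
      [(a+b+c+d - lambda)(a+c - lambda) = (a-c)^2],
    so [b + d] and [a + c] are both at least [lambda].  As [M] has trace
    [2 (a+b+c+d)], [mu = 2 (a+b+c+d) - 2 lambda >= 2 lambda].

    Conversely, the same equations with [a = c] force [a = c = lambda / 2],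
    [b + d = mu / 2] and [4 (d - b)^2 = mu (mu - 2 lambda)].  When
    [mu >= 2 lambda] these have a solution, and both [b] and [d] are positive in it because
    [mu (mu - 2 lambda) < mu^2]. *)

Import Order.TTheory GRing.Theory Num.Theory.
Local Open Scope ring_scope.

Definition C4_laplacian {R : realType} (a b c d : R) : 'M[R]_4 :=
  \matrix_(i, j) nth 0 (nth [::]
    [:: [:: a + d; - a; 0; - d];
        [:: - a; a + b; - b; 0];
        [:: 0; - b; b + c; - c];
        [:: - d; 0; - c; c + d]] i) j.

Lemma SL_C4P {R : realType} (A : 'M[R]_4) :
  SL C4 A <->
  exists a b c d : R,
    [/\ 0 < a, 0 < b, 0 < c & 0 < d] /\ A = C4_laplacian a b c d.
Proof.
pose i0 : 'I_4 := inord 0; pose i1 : 'I_4 := inord 1.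
pose i2 : 'I_4 := inord 2; pose i3 : 'I_4 := inord 3.
have ordE (i : 'I_4) : [\/ i = i0, i = i1, i = i2 | i = i3].
  by case: i => [[|[|[|[|//]]]] lt_i];
    [constructor 1|constructor 2|constructor 3|constructor 4];
    apply: val_inj; rewrite /= inordK.
have rowE (B : 'M[R]_4) i :
    \sum_(k < 4 | k != i) B i k = B i i0 + B i i1 + B i i2 + B i i3 - B i i.
  transitivity (\sum_k B i k - B i i).
    by rewrite [in RHS](bigD1 i) //= addrAC subrr add0r.
  rewrite !big_ord_recl big_ord0 addr0 !addrA; congr (_ - _).
  by do !congr (_ + _); congr (B i _); apply: val_inj; rewrite /= ?inordK.
split=> [[symA negA nonA diagA] | [a [b [c [d [[a0 b0 c0 d0] ->]]]]]].
  have sym i j : A i j = A j i by rewrite -{1}symA mxE.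
  have neg i j : cycle_adj i j -> 0 < - A i j.
    by move=> ij; rewrite oppr_gt0; apply: negA.
  exists (- A i0 i1), (- A i1 i2), (- A i2 i3), (- A i3 i0); split.
    by split; apply: neg; rewrite /cycle_adj -!val_eqE /= !inordK.
  have A02 : A i0 i2 = 0.
    by apply: nonA; rewrite /= /cycle_adj -!val_eqE /= !inordK.
  have A13 : A i1 i3 = 0.
    by apply: nonA; rewrite /= /cycle_adj -!val_eqE /= !inordK.
  have diag i := diagA i; have := (diag i0, diag i1, diag i2, diag i3).
  rewrite !rowE (sym i1 i0) (sym i2 i0) (sym i2 i1) (sym i0 i3) (sym i3 i1).
  rewrite (sym i3 i2) A02 A13 => -[[[d0 d1] d2] d3].
  apply/matrixP=> i j.
  by case: (ordE i) => ->; case: (ordE j) => ->; rewrite mxE !inordK //= ?opprK;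
    rewrite ?(sym i1 i0) ?(sym i2 i0) ?(sym i2 i1) ?(sym i0 i3) ?(sym i3 i1)
      ?(sym i3 i2) ?A02 ?A13 //; lra.
split.
- apply/matrixP=> i j.
  by case: (ordE i) => ->; case: (ordE j) => ->; rewrite !mxE !inordK.
- move=> i j; case: (ordE i) => ->; case: (ordE j) => ->;
  by rewrite /= /cycle_adj -!val_eqE /= !mxE !inordK //= oppr_lt0.
- move=> i j; case: (ordE i) => ->; case: (ordE j) => ->;
  by rewrite /= /cycle_adj -!val_eqE /= !mxE !inordK.
- move=> i; rewrite rowE.
  by case: (ordE i) => ->; rewrite !mxE !inordK //=; lra.
Qed.

Lemma det_mx33 {R : comNzRingType} (A : 'M[R]_3) :
  let i0 := inord 0 in let i1 := inord 1 in let i2 := inord 2 in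
  \det A = A i0 i0 * (A i1 i1 * A i2 i2 - A i1 i2 * A i2 i1)
          - A i0 i1 * (A i1 i0 * A i2 i2 - A i1 i2 * A i2 i0)
          + A i0 i2 * (A i1 i0 * A i2 i1 - A i1 i1 * A i2 i0).
Proof.
move=> i0 i1 i2.
pose a i j := A (inord i) (inord j).
have aE (i j : 'I_3) : A i j = a i j by rewrite /a !inord_val.
rewrite !aE !inordK // (expand_det_row _ ord0) !big_ord_recl big_ord0.
rewrite /cofactor !(expand_det_row _ ord0) !big_ord_recl !big_ord0.
by rewrite /cofactor !det_mx11 !mxE !aE /= /bump /=; ring.
Qed.

(** The coefficients are grouped as the trace, the sum of the principal 2-minors
    and the determinant of the block [M], the shape in which subtracting
    [lambda] from the diagonal of [M] is visible. *)
Lemma char_poly_C4_laplacian {R : realType} (a b c d : R) :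
  let S := a + b + c + d in
  char_poly (C4_laplacian a b c d) =
    'X^4 - (2 * S)%:P * 'X^3
    + (S * (b + d) + S * (a + c) + (b + d) * (a + c)
       - (d - b) ^+ 2 - (a - c) ^+ 2)%:P * 'X^2
    - (S * (b + d) * (a + c) - (d - b) ^+ 2 * (a + c)
       - (a - c) ^+ 2 * (b + d))%:P * 'X.
Proof.
rewrite /char_poly /char_poly_mx (expand_det_row _ ord0).
rewrite !big_ord_recl big_ord0 /cofactor !det_mx33 !mxE -!val_eqE /=.
rewrite !inordK // /bump /=.
ring.
Qed.

Lemma quartic_inj {R : realType} (s1 s2 s3 t1 t2 t3 : R) :
  'X^4 - s1%:P * 'X^3 + s2%:P * 'X^2 - s3%:P * 'X =
  'X^4 - t1%:P * 'X^3 + t2%:P * 'X^2 - t3%:P * 'X ->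
  [/\ s1 = t1, s2 = t2 & s3 = t3].
Proof.
move=> /polyP eq_st; have := (eq_st 3%N, eq_st 2%N, eq_st 1%N).
rewrite !(coefB, coefD, coefXn, coefCM, coefX) /= => -[[h3 h2] h1].
by split; lra.
Qed.

(** Vieta's formulas for the 3 by 3 block [M] of the Laplacian. *)
Lemma spectrum_C4_laplacian {R : realType} (a b c d x y z : R) :
  let S := a + b + c + d in
  is_spectrum [tuple 0; x; y; z] (C4_laplacian a b c d) <->
  [/\ 2 * S = x + y + z,
      S * (b + d) + S * (a + c) + (b + d) * (a + c)
        - (d - b) ^+ 2 - (a - c) ^+ 2 = x * y + x * z + y * z
    & S * (b + d) * (a + c) - (d - b) ^+ 2 * (a + c)
        - (a - c) ^+ 2 * (b + d) = x * y * z].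
Proof.
move=> S; rewrite /is_spectrum char_poly_C4_laplacian -/S.
have -> : \prod_(t <- [tuple 0; x; y; z]) ('X - t%:P) =
    'X^4 - (x + y + z)%:P * 'X^3 + (x * y + x * z + y * z)%:P * 'X^2
    - (x * y * z)%:P * 'X.
  by rewrite /= !big_cons big_nil; ring.
by split=> [/quartic_inj // | [-> -> ->]].
Qed.

(** For a real symmetric matrix with rows [(u, p, q)], [(p, v, 0)] and
    [(q, 0, w)], a double eigenvalue 0 means that the determinant and the sum
    of the principal 2-minors vanish.  The squared Frobenius norm of the
    adjugate is the square of its trace (the sum of the minors) minus
    twice its second symmetric function (determinant times trace), hence is
    zero. *)
Lemma principal_minors_eq0 {R : realType} (u v w p q : R) :
  (u * v - p ^+ 2) + (u * w - q ^+ 2) + v * w = 0 ->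
  u * v * w - p ^+ 2 * w - q ^+ 2 * v = 0 ->
  [/\ u * v = p ^+ 2, u * w = q ^+ 2 & v * w = 0].
Proof.
move=> minors0 det0.
pose m1 := u * v - p ^+ 2; pose m2 := u * w - q ^+ 2; pose m3 := v * w.
have norm_adj : m1 ^+ 2 + m2 ^+ 2 + m3 ^+ 2
    + 2 * ((p * w) ^+ 2 + (q * v) ^+ 2 + (p * q) ^+ 2) = 0.
  transitivity ((m1 + m2 + m3) ^+ 2
      - 2 * (u * v * w - p ^+ 2 * w - q ^+ 2 * v) * (u + v + w)).
    by rewrite /m1 /m2 /m3; ring.
  by rewrite /m1 /m2 /m3 minors0 det0; ring.
have := (sqr_ge0 m1, sqr_ge0 m2, sqr_ge0 m3).
have := (sqr_ge0 (p * w), sqr_ge0 (q * v), sqr_ge0 (p * q)).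
move=> -[[h1 h2] h3] -[[h4 h5] h6].
have sq0 (t : R) : t ^+ 2 = 0 -> t = 0.
  by move/eqP; rewrite sqrf_eq0 => /eqP.
have m10 : m1 = 0 by apply: sq0; lra.
have m20 : m2 = 0 by apply: sq0; lra.
have m30 : m3 = 0 by apply: sq0; lra.
by split; [apply/subr0_eq | apply/subr0_eq |].
Qed.

Theorem theorem3p14 (R : realType) (lambda mu : R) (lambda_gt0 : 0 < lambda) :
  laplacian_realizable C4 [tuple 0; lambda; lambda; mu] <-> 2 * lambda <= mu.
Proof.
split=> [[A [/SL_C4P [a [b [c [d [[a0 b0 c0 d0] ->]]]]]]] | le_mu].
  move=> /spectrum_C4_laplacian [e1 e2 e3].
  set S := a + b + c + d in e1 e2 e3.
  have muE : mu = 2 * S - 2 * lambda by lra.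
  rewrite {e1}muE in e2 e3 *.
  (* These are the entries of [M - lambda]. *)
  have [||m1 m2 m3] := @principal_minors_eq0 _ (S - lambda) (b + d - lambda)
    (a + c - lambda) (d - b) (a - c).
  - by rewrite /S in e2 *; lra.
  - by rewrite /S in e2 e3 *; nra.
  (* [lambda] is [b + d] or [a + c], one pair of opposite weights short of S. *)
  have S_gt : 0 < S - lambda.
    by move/eqP: m3; rewrite mulf_eq0 /S => /orP[] /eqP; lra.
  have bd_ge : 0 <= b + d - lambda.
    by rewrite -(pmulr_rge0 _ S_gt) m1 sqr_ge0.
  have ac_ge : 0 <= a + c - lambda.
    by rewrite -(pmulr_rge0 _ S_gt) m2 sqr_ge0.
  by rewrite /S; lra.
have disc_ge0 : 0 <= mu * (mu - 2 * lambda) by apply: mulr_ge0; lra.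
pose r := Num.sqrt (mu * (mu - 2 * lambda)).
have r2 : r ^+ 2 = mu * (mu - 2 * lambda) by rewrite sqr_sqrtr.
have r_ge0 : 0 <= r by apply: sqrtr_ge0.
have r_lt : r < mu.
  rewrite -(@ltr_pXn2r _ 2) ?nnegrE //; last by lra.
  by rewrite r2; nra.
exists (C4_laplacian (lambda / 2) ((mu - r) / 4) (lambda / 2) ((mu + r) / 4)).
split.
  apply/SL_C4P; do 4!eexists; split; last by [].
  by split; lra.
apply/spectrum_C4_laplacian.
have -> : (mu + r) / 4 - (mu - r) / 4 = r / 2 by field.
by rewrite exprMn r2; split; field.
Qed.
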